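(* Let $R$ be a commutative ring and $M$ a nonzero finitely generated $R$-module. The following statements are equivalent: (1) $M$ is weakly-morphic and reduced; (2) $R/\mathrm{Ann}_R(M)$ is a regular ring; (3) $M$ is weakly-endoregular; (4) $M$ is weakly JT-regular; (5) $M$ is F-regular; (6) every cyclic submodule of $M$ has property $P$, where $P$ is any one (fixed) of the following properties, each choice giving a statement equivalent to the others: ''weakly-morphic and reduced'', ''morphic and reduced'', ''weakly-endoregular'', ''Abelian endoregular'', ''co-reduced'', ''weakly JT-regular'', ''F-regular''.
   Context: Rings are associative and unital; modules are unitary. A ring $T$ is (von Neumann) regular if for each $a\in T$ there is $y\in T$ with $a=aya$. $\mathrm{Ann}_R(M)=\{a\in R: Ma=0\}$. For an $R$-module $N$ and $a\in R$ put $l_N(a)=\{n\in N: na=0\}$. Definitions for an $R$-module $N$ over a commutative ring $R$: - $N$ is morphic if $N/\varphi(N)\cong\ker(\varphi)$ as $R$-modules for every $\varphi\in\mathrm{End}_R(N)$. - $N$ is weakly-morphic if $N/Na\cong l_N(a)$ as $R$-modules for each $a\in R$. - $N$ is reduced if whenever $a\in R$, $n\in N$ satisfy $na^2=0$, then $nRa=0$. - $N$ is co-reduced if $Na=Na^k$ for every $a\in R$ and every positive integer $k$. - $N$ is weakly-endoregular if $Na$ and $l_N(a)$ are direct summands of $N$ for each $a\in R$. - $N$ is weakly JT-regular if $Na=Na^2$ for each $a\in R$. - $N$ is F-regular if for every submodule $K$ of $N$ the sequence $0\to K\otimes_R E\to N\otimes_R E$ is exact for each $R$-module $E$. - $N$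 is Abelian endoregular if $T=\mathrm{End}_R(N)$ is a strongly regular ring, i.e. for each $t\in T$ there is $y\in T$ with $t=t^2y$. *)

(* Defs.v *)
From HB Require Import structures.
From mathcomp Require Import all_boot all_algebra generic_quotient ring_quotient.
From mathcomp Require Import boolp freeg.

Set Implicit Arguments.
Unset Strict Implicit.
Unset Printing Implicit Defensive.

Import GRing.Theory.
Local Open Scope ring_scope.
Local Open Scope quotient_scope.

(* R is commutative, so a (right) R-module is an [lmodType R] and n a is
   written [a *: n].  [comPzRingType] allows the zero ring.  Subsets are boolean
   predicates; [`[< P >]] turns an arbitrary proposition into a boolean, so no
   decidability is assumed. *)

Section SubQuotient.
Variables (R : pzRingType) (V : lmodType R) (K : submodClosed V).

Definition sub_lmod : Type := {x : V | x \in K}.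
HB.instance Definition _ := SubChoice.on sub_lmod.
HB.instance Definition _ := [SubChoice_isSubLmodule of sub_lmod by <:].

(* A [submodClosed] predicate is not canonically [zmodClosed], which is what
   [Quotient.quot] expects. *)
Definition mem_submod : {pred V} := fun x => x \in K.
HB.instance Definition _ := GRing.isZmodClosed.Build V mem_submod
  (GRing.submod_closedB (submodClosedP K)).

Definition quot_lmod : Type := Quotient.quot mem_submod.
HB.instance Definition _ := GRing.Zmodule.on quot_lmod.
HB.instance Definition _ := EqQuotient.on quot_lmod.

Lemma eq_quot_lmod (x y : V) :
  (\pi_quot_lmod x == \pi_quot_lmod y) = (x - y \in K).
Proof. exact: (esym (Quotient.idealrBE mem_submod x y)). Qed.

Lemma pi_quot_lmodD : {morph \pi_quot_lmod : x y / x + y}.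
Proof. by move=> x y; rewrite [LHS]Quotient.pi_add. Qed.

Definition quot_scale (a : R) (x : quot_lmod) : quot_lmod :=
  \pi_quot_lmod (a *: repr x).

Lemma pi_quot_scale a (x : V) :
  quot_scale a (\pi_quot_lmod x) = \pi_quot_lmod (a *: x).
Proof.
apply/eqP; rewrite eq_quot_lmod -scalerBr rpredZ //.
by rewrite -eq_quot_lmod reprK.
Qed.

Fact quot_scaleA a b x : quot_scale a (quot_scale b x) = quot_scale (a * b) x.
Proof. by rewrite -[x]reprK (pi_quot_scale b) !pi_quot_scale scalerA. Qed.

Fact quot_scale1 : left_id 1 quot_scale.
Proof. by move=> x; rewrite -[x]reprK pi_quot_scale scale1r. Qed.

Fact quot_scaleDr : right_distributive quot_scale +%R.
Proof.
move=> a x y; rewrite -[x]reprK -[y]reprK -pi_quot_lmodD.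
by rewrite !pi_quot_scale -pi_quot_lmodD scalerDr.
Qed.

Fact quot_scaleDl x : {morph quot_scale^~ x : a b / a + b}.
Proof.
by move=> a b; rewrite -[x]reprK !pi_quot_scale -pi_quot_lmodD scalerDl.
Qed.

HB.instance Definition _ := GRing.Zmodule_isLmodule.Build R quot_lmod
  quot_scaleA quot_scale1 quot_scaleDr quot_scaleDl.
End SubQuotient.

(* An ideal is a submodule of the regular module [R^o]; unlike [{ideal_quot I}],
   this quotient does not require I to be proper. *)
Section QuotientRing.
Variables (R : comPzRingType) (I : submodClosed R^o).

Definition quot_ring : Type := quot_lmod I.
HB.instance Definition _ := GRing.Zmodule.on quot_ring.
HB.instance Definition _ := EqQuotient.on quot_ring.

Definition quot_mul (x y : quot_ring) : quot_ring :=
  \pi_quot_ring (repr x * repr y : R).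

Lemma pi_quot_mul (a b : R) :
  quot_mul (\pi_quot_ring a) (\pi_quot_ring b) = \pi_quot_ring (a * b : R).
Proof.
have piMr (c : R) (x : quot_ring) :
    \pi_quot_ring (c * repr x : R) = quot_scale c x by [].
rewrite /quot_mul piMr pi_quot_scale.
have -> : repr (\pi_quot_ring a) *: (b : R^o) = b * repr (\pi_quot_ring a).
  exact: mulrC.
rewrite piMr pi_quot_scale; congr (\pi_quot_ring _); exact: mulrC.
Qed.

Lemma pi_quot_ringD (a b : R) :
  \pi_quot_ring (a + b : R) = \pi_quot_ring a + \pi_quot_ring b.
Proof. exact: pi_quot_lmodD. Qed.

Fact quot_mulA : associative quot_mul.
Proof.
elim/quotW=> a; elim/quotW=> b; elim/quotW=> c.
by rewrite (pi_quot_mul b c) (pi_quot_mul a b) !pi_quot_mul mulrA.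
Qed.

Fact quot_mulC : commutative quot_mul.
Proof.
by elim/quotW=> a; elim/quotW=> b; rewrite !pi_quot_mul [X in _ = _ X]mulrC.
Qed.

Fact quot_mul1 : left_id (\pi_quot_ring (1 : R)) quot_mul.
Proof. by elim/quotW=> a; rewrite pi_quot_mul mul1r. Qed.

Fact quot_mulDl : left_distributive quot_mul +%R.
Proof.
elim/quotW=> a; elim/quotW=> b; elim/quotW=> c.
rewrite -pi_quot_ringD (pi_quot_mul a c) (pi_quot_mul b c) pi_quot_mul.
by rewrite -pi_quot_ringD mulrDl.
Qed.

HB.instance Definition _ := GRing.Zmodule_isComPzRing.Build quot_ring
  quot_mulA quot_mulC quot_mul1 quot_mulDl.
End QuotientRing.

Section EndomorphismRing.
Variables (R : pzRingType) (N : lmodType R).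

Definition endo : Type := {linear N -> N}.
HB.instance Definition _ := gen_eqMixin endo.
HB.instance Definition _ := gen_choiceMixin endo.

Definition endo_fun (f : endo) : {linear N -> N} := f.

Lemma endoP (f g : endo) : endo_fun f =1 endo_fun g -> f = g.
Proof.
case: f g => [f [[fD] [fZ]]] [g [[gD] [gZ]]] fg.
have {}fg : f = g by apply: funext => x; apply: fg.
case: g / fg gD gZ => gD gZ.
by rewrite (Prop_irrelevance gD fD) (Prop_irrelevance gZ fZ).
Qed.

Definition endo_zero : endo := \0 : {linear N -> N}.
Definition endo_one : endo := idfun : {linear N -> N}.
Definition endo_opp (f : endo) : endo := \- endo_fun f : {linear N -> N}.
Definition endo_add (f g : endo) : endo :=
  endo_fun f \+ endo_fun g : {linear N -> N}.
Definition endo_mul (f g : endo) : endo :=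
  endo_fun f \o endo_fun g : {linear N -> N}.

Fact endo_addA : associative endo_add.
Proof. by move=> f g h; apply: endoP => x /=; rewrite addrA. Qed.
Fact endo_addC : commutative endo_add.
Proof. by move=> f g; apply: endoP => x /=; rewrite addrC. Qed.
Fact endo_add0 : left_id endo_zero endo_add.
Proof. by move=> f; apply: endoP => x /=; rewrite add0r. Qed.
Fact endo_addN : left_inverse endo_zero endo_opp endo_add.
Proof. by move=> f; apply: endoP => x /=; rewrite addNr. Qed.
Fact endo_mulA : associative endo_mul.
Proof. by move=> f g h; apply: endoP. Qed.
Fact endo_mul1l : left_id endo_one endo_mul.
Proof. by move=> f; apply: endoP. Qed.
Fact endo_mul1r : right_id endo_one endo_mul.
Proof. by move=> f; apply: endoP. Qed.
Fact endo_mulDl : left_distributive endo_mul endo_add.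
Proof. by move=> f g h; apply: endoP. Qed.
Fact endo_mulDr : right_distributive endo_mul endo_add.
Proof. by move=> f g h; apply: endoP => x /=; rewrite raddfD. Qed.

HB.instance Definition _ := GRing.isPzRing.Build endo
  endo_addA endo_addC endo_add0 endo_addN
  endo_mulA endo_mul1l endo_mul1r endo_mulDl endo_mulDr.
End EndomorphismRing.

(* U (x) V is the free abelian group on U x V modulo the smallest subgroup
   containing the biadditivity and R-balance relations. *)
Section TensorProduct.
Variables (R : comPzRingType) (U V : lmodType R).

Local Notation free := {freeg (U * V)%type / int}.
Local Notation gen u v := (<< (u, v) >> : free).

Definition tensor_relations (S : {pred free}) : Prop :=
  [/\ forall u u' v, gen (u + u') v - gen u v - gen u' v \in S,
      forall u v v', gen u (v + v') - gen u v - gen u v' \in S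
    & forall a u v, gen (a *: u) v - gen u (a *: v) \in S].

Definition tensor_rel : {pred free} :=
  fun x => `[< forall S : zmodClosed free, tensor_relations S -> x \in S >].

Fact tensor_rel_zmod_closed : zmod_closed tensor_rel.
Proof.
split=> [|x y /asboolP Kx /asboolP Ky]; apply/asboolP => S relS.
  exact: rpred0.
by rewrite rpredB ?Kx ?Ky.
Qed.
HB.instance Definition _ :=
  GRing.isZmodClosed.Build free tensor_rel tensor_rel_zmod_closed.

Definition tensor : Type := Quotient.quot tensor_rel.
HB.instance Definition _ := GRing.Zmodule.on tensor.
HB.instance Definition _ := EqQuotient.on tensor.

Definition tensor_class (x : free) : tensor := \pi_tensor x.
Definition tpure (u : U) (v : V) : tensor := tensor_class (gen u v).

Lemma tensor_classP (x y : free) :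
  reflect (tensor_class x = tensor_class y) (x - y \in tensor_rel).
Proof.
by have -> := Quotient.idealrBE tensor_rel x y; apply: eqP.
Qed.

Lemma tensor_classB : {morph tensor_class : x y / x - y}.
Proof.
by move=> x y; rewrite /tensor_class [LHS]Quotient.pi_add Quotient.pi_opp.
Qed.

Lemma tensor_rel_relations : tensor_relations tensor_rel.
Proof.
by split=> *; apply/asboolP => S [SDl SDr SZ]; [apply: SDl|apply: SDr|apply: SZ].
Qed.
End TensorProduct.
Arguments tensor_rel {R} U V _.
Arguments tensor_rel_relations {R} U V.

(* f (x) E, induced by the map (u, e) |-> (f u, e) of generators. *)
Section TensorMap.
Variables (R : comPzRingType) (U V E : lmodType R) (f : {linear U -> V}).

Definition free_map (x : {freeg (U * E)%type / int}) :
    {freeg (V * E)%type / int} :=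
  fglift (fun p : U * E => << (f p.1, p.2) >> : {freeg (V * E)%type / int}) x.

Definition tensor_map (t : tensor U E) : tensor V E :=
  tensor_class (free_map (repr t)).

Lemma free_mapB : {morph free_map : x y / x - y}.
Proof. by move=> x y; rewrite /free_map lift_is_additive. Qed.

Lemma free_map_gen u e :
  free_map (<< (u, e) >> : {freeg (U * E)%type / int}) = << (f u, e) >>.
Proof. by rewrite /free_map liftU scale1r. Qed.

Lemma free_map_rel x :
  x \in tensor_rel U E -> free_map x \in tensor_rel V E.
Proof.
have [relDl relDr relZ] := tensor_rel_relations V E.
pose S : {pred {freeg (U * E)%type / int}} :=
  fun x => free_map x \in tensor_rel V E.
have SE y : (y \in S) = (free_map y \in tensor_rel V E) by [].
have S_closed : zmod_closed S.
  split=> [|y z]; rewrite !SE ?free_mapB; last exact: rpredB.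
  by rewrite -[X in free_map X](subrr 0) free_mapB subrr; apply: rpred0.
pose HS := GRing.isZmodClosed.Build _ S S_closed.
pose SS : zmodClosed _ := HB.pack S HS.
move=> /asboolP /(_ SS); apply; split=> *.
- by rewrite SE !free_mapB !free_map_gen raddfD; apply: relDl.
- by rewrite SE !free_mapB !free_map_gen; apply: relDr.
- by rewrite SE !free_mapB !free_map_gen linearZ; apply: relZ.
Qed.

Lemma tensor_map_class x :
  tensor_map (tensor_class x) = tensor_class (free_map x).
Proof.
apply/tensor_classP; rewrite -free_mapB; apply: free_map_rel.
by apply/tensor_classP; rewrite /tensor_class reprK.
Qed.

Lemma tensor_map_pure u e : tensor_map (tpure u e) = tpure (f u) e.
Proof. by rewrite tensor_map_class free_map_gen. Qed.

Lemma tensor_mapB : {morph tensor_map : s t / s - t}.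
Proof.
elim/quotW=> x; elim/quotW=> y.
by rewrite -tensor_classB !tensor_map_class free_mapB tensor_classB.
Qed.
End TensorMap.

Section Submodules.
Variables (R : comPzRingType) (N : lmodType R).

Definition lmod_ker (f : {linear N -> N}) : {pred N} := fun n => f n == 0.
Definition lmod_im (f : {linear N -> N}) : {pred N} :=
  fun n => `[< exists m, n = f m >].

(* N a and l_N(a) *)
Definition scaled (a : R) : {pred N} := fun n => `[< exists m : N, n = a *: m >].
Definition killed_by (a : R) : {pred N} := fun n => a *: n == 0.

Definition annihilator : {pred R^o} :=
  fun a : R => `[< forall n : N, a *: n = 0 >].

Fact lmod_ker_closed f : submod_closed (lmod_ker f).
Proof.
split=> [|a x y]; rewrite !unfold_in ?linear0 // => /eqP fx /eqP fy.
by rewrite linearP fx fy scaler0 addr0.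
Qed.
HB.instance Definition _ f :=
  GRing.isSubmodClosed.Build R N (lmod_ker f)
    (GRing.submod_closed_semi (lmod_ker_closed f)).

Fact lmod_im_closed f : submod_closed (lmod_im f).
Proof.
split=> [|a _ _ /asboolP[m ->] /asboolP[n ->]]; apply/asboolP.
  by exists 0; rewrite linear0.
by exists (a *: m + n); rewrite linearP.
Qed.
HB.instance Definition _ f :=
  GRing.isSubmodClosed.Build R N (lmod_im f)
    (GRing.submod_closed_semi (lmod_im_closed f)).

Fact scaled_closed a : submod_closed (scaled a).
Proof.
split=> [|b _ _ /asboolP[m ->] /asboolP[n ->]]; apply/asboolP.
  by exists 0; rewrite scaler0.
by exists (b *: m + n); rewrite scalerDr !scalerA mulrC.
Qed.
HB.instance Definition _ a :=
  GRing.isSubmodClosed.Build R N (scaled a)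
    (GRing.submod_closed_semi (scaled_closed a)).

Fact killed_by_closed a : submod_closed (killed_by a).
Proof.
split=> [|b x y]; rewrite !unfold_in ?scaler0 // => /eqP ax /eqP ay.
by rewrite scalerDr scalerA mulrC -scalerA ax ay scaler0 addr0.
Qed.
HB.instance Definition _ a :=
  GRing.isSubmodClosed.Build R N (killed_by a)
    (GRing.submod_closed_semi (killed_by_closed a)).

Fact annihilator_closed : submod_closed annihilator.
Proof.
split=> [|b x y /asboolP ax /asboolP ay]; apply/asboolP => n.
  by rewrite scale0r.
by rewrite scalerDl -scalerA ax ay scaler0 addr0.
Qed.
HB.instance Definition _ :=
  GRing.isSubmodClosed.Build R R^o annihilator
    (GRing.submod_closed_semi annihilator_closed).
End Submodules.
Arguments scaled {R} N a _.
Arguments killed_by {R} N a _.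
Arguments annihilator {R} N _.

Definition lmod_iso (R : pzRingType) (U V : lmodType R) : Prop :=
  exists f : {linear U -> V}, bijective f.

Definition von_neumann_regular (T : pzRingType) : Prop :=
  forall a : T, exists y : T, a = a * y * a.

Definition strongly_regular (T : pzRingType) : Prop :=
  forall t : T, exists y : T, t = t ^+ 2 * y.

Section ModuleProperties.
Variables (R : comPzRingType) (N : lmodType R).

Definition nonzero_module : Prop := exists n : N, n != 0.

Definition finitely_generated : Prop :=
  exists (k : nat) (g : 'I_k -> N),
    forall n : N, exists c : 'I_k -> R, n = \sum_(i < k) c i *: g i.

Definition direct_summand (K : submodClosed N) : Prop :=
  exists L : submodClosed N,
    (forall n : N, exists k l, [/\ k \in K, l \in L & n = k + l]) /\
    (forall n : N, n \in K -> n \in L -> n = 0).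

Definition cyclic_submod (K : submodClosed N) : Prop :=
  exists m : N, forall x : N, x \in K <-> exists a : R, x = a *: m.

Definition morphic : Prop :=
  forall f : {linear N -> N},
    lmod_iso (quot_lmod (lmod_im f)) (sub_lmod (lmod_ker f)).

Definition weakly_morphic : Prop :=
  forall a : R, lmod_iso (quot_lmod (scaled N a)) (sub_lmod (killed_by N a)).

Definition reduced_module : Prop :=
  forall (a : R) (n : N), a ^+ 2 *: n = 0 -> forall r : R, a *: (r *: n) = 0.

Definition co_reduced : Prop :=
  forall (a : R) (k : nat), (0 < k)%N -> scaled N a =i scaled N (a ^+ k).

Definition weakly_endoregular : Prop :=
  forall a : R, direct_summand (scaled N a) /\ direct_summand (killed_by N a).

Definition weakly_JT_regular : Prop :=
  forall a : R, scaled N a =i scaled N (a ^+ 2).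

(* Exactness of 0 -> K (x) E -> N (x) E is injectivity of the second map; it
   does not involve the scalar action on the tensor products, which are only
   given their abelian group structure here. *)
Definition F_regular : Prop :=
  forall (K : submodClosed N) (E : lmodType R),
    injective (tensor_map (E := E) (\val : {linear sub_lmod K -> N})).

Definition abelian_endoregular : Prop := strongly_regular (endo N).
End ModuleProperties.

Definition every_cyclic_submod (R : comPzRingType)
    (P : forall N : lmodType R, Prop) (M : lmodType R) : Prop :=
  forall K : submodClosed M, cyclic_submod K -> P (sub_lmod K).

(* Main.v *)
Require Import Defs.
From HB Require Import structures.
From mathcomp Require Import all_boot all_algebra.
From mathcomp Require Import generic_quotient ring_quotient.
From mathcomp Require Import boolp freeg ring.

Set Implicit Arguments.
Unset Strict Implicit.
Unset Printing Implicit Defensive.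

Import GRing.Theory.
Local Open Scope ring_scope.
Local Open Scope quotient_scope.

(** Each of the twelve properties of M is equivalent to one equational
    condition, [uniformly_regular M]: every scalar a has a y with a = y a^2 as
    operators on M. This says that R/Ann(M) is regular, and it gives an
    operator ya on M that is the projection onto Ma along l_M(a).

    From the equation everything else is read off: Ma = Ma^2, M = Ma + l_M(a)
    with zero intersection, hence M/Ma is isomorphic to l_M(a), and na^2 = 0
    forces na = 0.

    Conversely, the properties of M itself lead to Ma = Ma^2. If M is reduced and
    weakly morphic, then M/Ma^2 is isomorphic to l_M(a^2) = l_M(a), so that a
    kills M/Ma^2 ([weakly_JT_regular_of_lmod_iso]). A complement L of Ma has
    La inside both L and Ma, so La = 0 and Ma = (Ma + L)a = Ma^2. If M is
    F-regular, then Ma (x) R/aR injects into M (x) R/aR, where na (x) 1 =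
    n (x) a = 0; the first group maps to Ma/Ma^2, so na lies in Ma^2
    ([F_regular_JT]). Finally Ma = Ma^2 means that the module Ma equals a
    times itself, and for finitely generated M Nakayama's argument produces a
    scalar 1 - ya that kills Ma ([weakly_JT_uniformly_regular]).

    The remaining step is that uniform regularity implies F-regularity. The
    generators of M are adjoined one at a time, so it suffices to treat an
    embedding f : U -> V with V = f(U) + Rg ([tensor_map_adjoin_inj]). In
    general f has no linear retraction, but regularity makes any finitely many
    linear conditions on one solvable: sending f(u) + cg to u + cw, for a
    suitable w in U, respects any finite set of linear relations. A proof that
    an element vanishes in V (x) E uses only finitely many relations, so it is
    carried back to U (x) E.

    For cyclic submodules two facts are added. An endomorphism of a cyclic
    module is multiplication by a scalar, so morphic means weakly morphic and
    strong regularity of the endomorphism ring means uniform regularity. And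
    when M is finitely generated, the scalars y that serve the generators one
    by one combine into one that serves M, because the factors 1 - ya
    multiply ([uniformly_regular_of_pointwise]). *)

(** * Uniformly regular modules *)

Definition uniformly_regular (R : comPzRingType) (N : lmodType R) : Prop :=
  forall a : R, exists y : R, forall n : N, a *: n = (y * a ^+ 2) *: n.

Section Regular.
Variables (R : comPzRingType) (N : lmodType R).

Lemma scaledP a (n : N) : reflect (exists m, n = a *: m) (n \in scaled N a).
Proof. exact: asboolP. Qed.

Lemma killed_byP a (n : N) : reflect (a *: n = 0) (n \in killed_by N a).
Proof. exact: eqP. Qed.

Lemma scaled_expS a k : {subset scaled N (a ^+ k.+1) <= scaled N a}.
Proof.
move=> _ /scaledP[m ->]; apply/scaledP; exists (a ^+ k *: m).
by rewrite scalerA -exprS.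
Qed.

(** The equation a = y a^2 on N is the regularity equation a = a y a, read in
    the commutative ring R/Ann(N). *)
Lemma quot_ring_annihilator_regular :
  von_neumann_regular (quot_ring (annihilator N)) <-> uniformly_regular N.
Proof.
have piE (a b : R) : \pi_(quot_ring (annihilator N)) a =
    \pi_(quot_ring (annihilator N)) b <-> forall n : N, a *: n = b *: n.
  have E := eq_quot_lmod (annihilator N) a b.
  split.
    move=> /eqP ab n; move: (ab); rewrite E => /asboolP/(_ n).
    by rewrite scalerBl => /eqP; rewrite subr_eq0 => /eqP.
  move=> ab; apply/eqP; rewrite E; apply/asboolP => n.
  by rewrite scalerBl ab subrr.
(* The representatives are given to [pi_quot_mul] explicitly because its left
   side unfolds to a class that matches it again. *)
have piM (a y : R) : \pi_(quot_ring (annihilator N)) a *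
    \pi_(quot_ring (annihilator N)) y * \pi_(quot_ring (annihilator N)) a =
    \pi_(quot_ring (annihilator N)) (y * a ^+ 2 : R).
  have -> : y * a ^+ 2 = a * y * a by ring.
  rewrite -(pi_quot_mul (annihilator N) (a * y) a).
  by rewrite -(pi_quot_mul (annihilator N) a y).
split=> reg a.
  have [y] := reg (\pi a); elim/quotW: y => y.
  by rewrite piM => /piE ay; exists y.
elim/quotW: a => a; have [y ay] := reg a.
by exists (\pi y); rewrite piM; apply/piE.
Qed.

End Regular.

(** * Quotients isomorphic to submodules *)

Section Isomorphisms.
Variables (R : comPzRingType) (N : lmodType R) (K L : submodClosed N).

Lemma pi_quot_lmodZ a (n : N) :
  \pi_(quot_lmod K) (a *: n) = a *: \pi_(quot_lmod K) n.
Proof. by rewrite -pi_quot_scale. Qed.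

Lemma pi_quot_lmod_eq0 (n : N) : \pi_(quot_lmod K) n = 0 <-> n \in K.
Proof.
have -> : (0 : quot_lmod K) = \pi 0.
  by rewrite -(scale0r (0 : N)) pi_quot_lmodZ scale0r.
split=> [/eqP|nK]; first by rewrite eq_quot_lmod subr0.
by apply/eqP; rewrite eq_quot_lmod subr0.
Qed.

Lemma projection_lmod_iso (p : {linear N -> N}) :
  (forall n, p n \in L) -> {in L, forall n, p n = n} ->
  (forall n, p n = 0 <-> n \in K) ->
  lmod_iso (quot_lmod K) (sub_lmod L).
Proof.
move=> pL pid pker.
have p_pi (n : N) : p (repr (\pi_(quot_lmod K) n)) = p n.
  apply/eqP; rewrite -subr_eq0 -raddfB; apply/eqP; apply/pker.
  by rewrite -eq_quot_lmod reprK.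
pose g (q : quot_lmod K) : sub_lmod L := Sub (p (repr q)) (pL _).
have gK n : val (g (\pi n)) = p n by rewrite SubK p_pi.
have g_lin : linear g.
  move=> a; elim/quotW=> m; elim/quotW=> n; apply: val_inj.
  have -> : a *: \pi_(quot_lmod K) m + \pi_(quot_lmod K) n
      = \pi_(quot_lmod K) (a *: m + n).
    by rewrite pi_quot_lmodD pi_quot_lmodZ.
  rewrite [RHS]linearP gK linearP.
  by congr (_ *: _ + _); apply/esym/gK.
pose gL := GRing.isLinear.Build R (quot_lmod K) (sub_lmod L) _ g g_lin.
exists (HB.pack_for {linear quot_lmod K -> sub_lmod L} g gL).
exists (fun x : sub_lmod L => \pi_(quot_lmod K) (val x)) => [|x].
  elim/quotW=> n; apply/eqP; rewrite gK eq_quot_lmod; apply/pker.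
  by rewrite linearB (pid _ (pL n)) subrr.
by apply: val_inj; rewrite /= p_pi pid // (valP x).
Qed.

(** The annihilator of a module is invariant under isomorphism; the annihilator
    of N/K is the set of b with Nb inside K. *)
Lemma lmod_iso_killers :
  lmod_iso (quot_lmod K) (sub_lmod L) ->
  forall b, {in L, forall n, b *: n = 0} <-> forall n : N, b *: n \in K.
Proof.
case=> f [g fK gK] b.
split=> [bL n|bK n nL].
  apply/pi_quot_lmod_eq0; apply: (can_inj fK).
  rewrite pi_quot_lmodZ linearZ linear0.
  by apply: val_inj; rewrite /= bL // (valP (f _)).
have -> : n = val (Sub n nL : sub_lmod L) by rewrite SubK.
rewrite -[Sub _ _]gK; elim/quotW: (g _) => m.
have /pi_quot_lmod_eq0 := bK m; rewrite pi_quot_lmodZ => bm0.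
transitivity (val (b *: f (\pi_(quot_lmod K) m))).
  by rewrite [RHS]linearZ.
by rewrite -linearZ bm0 !linear0.
Qed.

End Isomorphisms.

(** * Consequences and sources of uniform regularity *)

Section RegularModules.
Variables (R : comPzRingType) (N : lmodType R).

(** Reducedness gives l(a^2) = l(a), so a kills l(a^2) and therefore also
    N/Na^2. The submodules K and L are compared with Na and l(a) only through
    their elements: the kernel and image of the scaling endomorphism are
    different packed structures on the same subsets, and both morphic and weakly
    morphic modules are to be covered. *)
Lemma weakly_JT_regular_of_lmod_iso :
  (forall a : R, exists K L : submodClosed N,
    [/\ K =i scaled N a, L =i killed_by N a
      & lmod_iso (quot_lmod K) (sub_lmod L)]) ->
  reduced_module N -> weakly_JT_regular N.
Proof.
move=> iso red a n; apply/idP/idP; last exact: scaled_expS.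
move=> /scaledP[m ->].
have [K [L [KE LE /lmod_iso_killers kill]]] := iso (a ^+ 2).
rewrite -KE; apply: (kill a).1 => {}n; rewrite LE => /killed_byP an.
by rewrite -[n]scale1r; apply: red.
Qed.

(** If N = Na + L is direct, then La lies in the intersection of L and Na. *)
Lemma weakly_endoregular_JT : weakly_endoregular N -> weakly_JT_regular N.
Proof.
move=> end_reg a n; apply/idP/idP; last exact: scaled_expS.
have [[L [dec cap]] _] := end_reg a.
move=> /scaledP[m ->]; have [k [l [/scaledP[x ->] lL ->]]] := dec m.
apply/scaledP; exists x; rewrite scalerDr scalerA expr2.
rewrite [a *: l]cap ?addr0 //; last exact: rpredZ.
by apply/scaledP; exists l.
Qed.

Hypothesis regN : uniformly_regular N.

Lemma uniformly_regular_JT : weakly_JT_regular N.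
Proof.
move=> a n; apply/idP/idP; last exact: scaled_expS.
have [y ay] := regN a.
move=> /scaledP[m ->]; apply/scaledP; exists (y *: m).
by rewrite ay scalerA mulrC.
Qed.

Lemma scaled_cap_killed_by a n :
  n \in scaled N a -> n \in killed_by N a -> n = 0.
Proof.
have [y ay] := regN a.
move=> /scaledP[m ->] /killed_byP; rewrite scalerA -expr2 => a2m.
by rewrite ay -scalerA a2m scaler0.
Qed.

Lemma uniformly_regular_reduced : reduced_module N.
Proof.
move=> a n a2n r; rewrite scalerA mulrC -scalerA.
have [y ay] := regN a.
by rewrite ay -scalerA a2n !scaler0.
Qed.

Let complement_killed a y (n : N) :
  (forall x : N, a *: x = (y * a ^+ 2) *: x) ->
  n - (y * a) *: n \in killed_by N a.
Proof.
move=> ay; apply/killed_byP; rewrite scalerBr scalerA {1}ay.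
by rewrite (mulrCA a y) -expr2 subrr.
Qed.

Lemma uniformly_regular_endoregular : weakly_endoregular N.
Proof.
move=> a; have cap := @scaled_cap_killed_by a.
have [y ay] := regN a.
have im_part (n : N) : (y * a) *: n \in scaled N a.
  by apply/scaledP; exists (y *: n); rewrite scalerA mulrC.
split.
  exists (killed_by N a : submodClosed N); split=> [n|]; last exact: cap.
  exists ((y * a) *: n), (n - (y * a) *: n).
  by split; rewrite ?complement_killed // [RHS]addrC subrK.
exists (scaled N a : submodClosed N); split=> [n|n nk ns]; last exact: cap.
exists (n - (y * a) *: n), ((y * a) *: n).
by split; rewrite ?complement_killed ?subrK.
Qed.

(** The isomorphism is induced by the projection 1 - ya, whose kernel is Na and
    whose image is l(a). *)
Lemma uniformly_regular_lmod_iso (a : R) (K L : submodClosed N) :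
  K =i scaled N a -> L =i killed_by N a ->
  lmod_iso (quot_lmod K) (sub_lmod L).
Proof.
move=> KE LE; have [y ay] := regN a.
pose p : {linear N -> N} := idfun \- ( *:%R (y * a)).
have pE n : p n = n - (y * a) *: n by [].
apply: (@projection_lmod_iso _ _ _ _ p) => [n|n|n].
- by rewrite LE pE complement_killed.
- by rewrite LE pE => /killed_byP an; rewrite -scalerA an scaler0 subr0.
rewrite KE pE; split=> [/eqP|/scaledP[m ->]].
  rewrite subr_eq0 => /eqP ->; apply/scaledP; exists (y *: n).
  by rewrite scalerA mulrC.
by rewrite scalerA -mulrA -expr2 -ay subrr.
Qed.

Lemma uniformly_regular_weakly_morphic : weakly_morphic N.
Proof. by move=> a; apply: (@uniformly_regular_lmod_iso a). Qed.

End RegularModules.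

(** * Finitely generated modules *)

Section FinitelyGenerated.
Variables (R : comPzRingType) (N : lmodType R).

(** Spans are defined by recursion on the list of generators because every use
    eliminates one generator at a time. *)
Fixpoint in_span (s : seq N) (x : N) : Prop :=
  if s is g :: s' then exists c x', in_span s' x' /\ x = c *: g + x'
  else x = 0.

Lemma in_spanP s a x y :
  in_span s x -> in_span s y -> in_span s (a *: x + y).
Proof.
elim: s x y => [|g s IHs] x y /=; first by move=> -> ->; rewrite scaler0 addr0.
move=> [c [x' [sx ->]]] [d [y' [sy ->]]].
exists (a * c + d), (a *: x' + y'); split; first exact: IHs.
by rewrite scalerDr scalerA scalerDl addrACA.
Qed.

Lemma in_span0 s : in_span s 0.
Proof.
by elim: s => //= g s IHs; exists 0, 0; rewrite scale0r addr0.
Qed.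

Lemma in_spanZ s a x : in_span s x -> in_span s (a *: x).
Proof. by move=> sx; rewrite -[_ *: _]addr0; apply/in_spanP/in_span0. Qed.

Lemma finitely_generated_span :
  finitely_generated N -> exists s, forall x, in_span s x.
Proof.
move=> [k [g gen]]; exists [seq g i | i <- index_enum 'I_k] => x.
have [c ->] := gen x.
elim: (index_enum _) => [|i r IHr]; first by rewrite big_nil.
by rewrite big_cons; exists (c i), (\sum_(j <- r) c j *: g j).
Qed.

Let regular_at_iff a y (n : N) :
  a *: n = (y * a ^+ 2) *: n <-> (a * (1 - y * a)) *: n = 0.
Proof.
have -> : a * (1 - y * a) = a - y * a ^+ 2 by ring.
rewrite scalerBl; split=> [<-|/eqP]; first exact: subrr.
by rewrite subr_eq0 => /eqP.
Qed.

(** If a(1 - za) kills g and a(1 - ya) kills x, then a(1 - ya)(1 - za) kills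
    both, and (1 - ya)(1 - za) is again of the form 1 - y'a. *)
Lemma uniformly_regular_of_pointwise :
  finitely_generated N ->
  (forall a (n : N), exists y, a *: n = (y * a ^+ 2) *: n) ->
  uniformly_regular N.
Proof.
move=> /finitely_generated_span[s gen] reg a.
suff [y ay] : exists y, forall n, in_span s n -> (a * (1 - y * a)) *: n = 0.
  by exists y => n; apply/regular_at_iff/ay/gen.
elim: s {gen} => [|g s [y IHs]] /=; first by exists 0 => n ->; rewrite scaler0.
have [z /regular_at_iff az] := reg a g.
exists (y + z - y * z * a) => n [c [x [/IHs ax ->]]].
have -> : a * (1 - (y + z - y * z * a) * a) =
  (1 - y * a) * (a * (1 - z * a)) by ring.
rewrite scalerDr scalerA mulrC mulrA -scalerA az scaler0 add0r.
have -> : (1 - y * a) * (a * (1 - z * a)) =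
  (1 - z * a) * (a * (1 - y * a)) by ring.
by rewrite -scalerA ax scaler0.
Qed.

(** Nakayama's argument for the module Na, which equals its own multiple by a.
    Invariant: multiplication by 1 - ya carries Na into the multiple by a of the
    span of the generators that are left. Since ga = ma^2 for some m, the
    invariant at m expresses ga(1 - ya) as a^2 times a combination cg + x of
    those generators; moving the term in g to the left turns 1 - ya into
    1 - (y + c)a and leaves only x. The product of the two factors removes g
    from the list. *)
Lemma weakly_JT_uniformly_regular :
  finitely_generated N -> weakly_JT_regular N -> uniformly_regular N.
Proof.
move=> /finitely_generated_span[s gen] JT a.
have {gen} : exists y, forall n : N, exists x,
    in_span s x /\ (a * (1 - y * a)) *: n = a *: x.
  by exists 0 => n; exists n; rewrite mul0r subr0 mulr1.
elim: s => [|g s IHs] /= [y span_y].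
  exists y => n; apply/regular_at_iff; have [x [-> ->]] := span_y n.
  exact: scaler0.
apply: IHs.
have /scaledP[m agm] : a *: g \in scaled N (a ^+ 2).
  by rewrite -JT; apply/scaledP; exists g.
have [_ [[c [x [sx ->]]] mE]] := span_y m.
have gE : (a * (1 - (y + c) * a)) *: g = (a ^+ 2) *: x.
  have -> : a * (1 - (y + c) * a) = (1 - y * a) * a - a ^+ 2 * c by ring.
  rewrite scalerBl -[X in X - _]scalerA agm scalerA.
  have -> : (1 - y * a) * a ^+ 2 = a * (a * (1 - y * a)) by ring.
  rewrite -scalerA mE scalerA -expr2 scalerDr scalerA.
  by rewrite addrAC subrr add0r.
(* The scalar y' for which 1 - y'a = (1 - (y + c)a)(1 - ya). *)
exists (y + (y + c) * (1 - y * a)) => n.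
have [_ [[d [z [sz ->]]] nE]] := span_y n.
exists ((d * a) *: x + (1 - (y + c) * a) *: z); split.
  by apply: in_spanP => //; apply: in_spanZ.
have -> : a * (1 - (y + (y + c) * (1 - y * a)) * a) =
  (1 - (y + c) * a) * (a * (1 - y * a)) by ring.
rewrite -[LHS]scalerA nE scalerA scalerDr [in RHS]scalerDr !scalerA.
congr (_ + _); last by rewrite mulrC.
have -> : (1 - (y + c) * a) * a * d = d * (a * (1 - (y + c) * a)) by ring.
by rewrite -scalerA gE scalerA; congr (_ *: _); ring.
Qed.

Lemma finitely_generated_weakly_JT :
  finitely_generated N -> (weakly_JT_regular N <-> uniformly_regular N).
Proof.
move=> fgN; split; first exact: weakly_JT_uniformly_regular.
exact: uniformly_regular_JT.
Qed.

End FinitelyGenerated.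

(** * Cyclic modules *)

Section CyclicModules.
Variables (R : comPzRingType) (N : lmodType R) (g : N).
Hypothesis gen : forall x : N, exists a, x = a *: g.

Lemma cyclic_finitely_generated : finitely_generated N.
Proof.
exists 1%N, (fun=> g) => n; have [a ->] := gen n.
by exists (fun=> a); rewrite big_ord1.
Qed.

Lemma cyclic_endomorphism_scaling (f : {linear N -> N}) :
  exists a, forall x, f x = a *: x.
Proof.
have [a fg] := gen (f g); exists a => x; have [b ->] := gen x.
by rewrite linearZ fg /= !scalerA mulrC.
Qed.

Lemma cyclic_morphic_reduced :
  (morphic N /\ reduced_module N) <-> uniformly_regular N.
Proof.
split=> [[mor red]|reg].
  apply/(finitely_generated_weakly_JT cyclic_finitely_generated).
  apply: weakly_JT_regular_of_lmod_iso red => a.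
  exists (lmod_im ( *:%R a) : submodClosed N).
  by exists (lmod_ker ( *:%R a) : submodClosed N).
split; last exact: uniformly_regular_reduced.
move=> f; have [a fE] := cyclic_endomorphism_scaling f.
apply: (uniformly_regular_lmod_iso reg (a := a)) => n.
  by apply/asboolP/scaledP => -[m ->]; exists m; rewrite fE.
by apply/eqP/killed_byP; rewrite fE.
Qed.

Lemma cyclic_abelian_endoregular :
  abelian_endoregular N <-> uniformly_regular N.
Proof.
split=> [reg a|reg f].
  have [y ay] := reg ( *:%R a : {linear N -> N}).
  have [b bE] := cyclic_endomorphism_scaling (endo_fun y); exists b => n.
  rewrite -[LHS]/(endo_fun ( *:%R a : {linear N -> N}) n) ay.
  by rewrite /= bE !scalerA; congr (_ *: _); ring.
have [a fE] := cyclic_endomorphism_scaling (endo_fun f); have [y ay] := reg a.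
exists ( *:%R y : {linear N -> N}); apply: endoP => n.
rewrite -[RHS]/(endo_fun f (endo_fun f (y *: n))).
by rewrite !fE ay !scalerA; congr (_ *: _); ring.
Qed.

End CyclicModules.

(** * Tensor products by generators and relations *)

Section TensorRelations.
Variables (R : comPzRingType) (U E : lmodType R).
Local Notation free := {freeg (U * E)%type / int}.
Local Notation gen u e := (<< (u, e) >> : free).

Lemma tensor_rel_ind (P : free -> Prop) :
  P 0 -> (forall x y, P x -> P y -> P (x - y)) ->
  (forall u u' e, P (gen (u + u') e - gen u e - gen u' e)) ->
  (forall u e e', P (gen u (e + e') - gen u e - gen u e')) ->
  (forall a u e, P (gen (a *: u) e - gen u (a *: e))) ->
  forall x, x \in tensor_rel U E -> P x.
Proof.
move=> P0 PB PDl PDr PZ x /asboolP relx.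
pose S : {pred free} := fun x => `[< P x >].
have S_closed : zmod_closed S.
  by split=> [|y z /asboolP Py /asboolP Pz]; apply/asboolP; [|apply: PB].
pose HS := GRing.isZmodClosed.Build _ S S_closed.
pose SS : zmodClosed free := HB.pack S HS.
apply/asboolP; apply: (relx SS).
by split=> *; apply/asboolP.
Qed.

(** The universal property of the tensor product, with values compared modulo a
    subgroup S, so that a map that is bilinear only modulo S needs no quotient.
    The codomain of [fglift] must be a module over int, whence [zmodule]. *)
Lemma tensor_rel_lift (W : zmodType) (S : zmodClosed W) (h : U -> E -> W) :
  (forall u u' e, h (u + u') e - h u e - h u' e \in S) ->
  (forall u e e', h u (e + e') - h u e - h u e' \in S) ->
  (forall a u e, h (a *: u) e - h u (a *: e) \in S) ->
  forall x, x \in tensor_rel U E ->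
    (fglift (fun p : U * E => h p.1 p.2 : zmodule W) x : W) \in S.
Proof.
move=> hDl hDr hZ.
pose l := fglift (fun p : U * E => h p.1 p.2 : zmodule W).
have lB : {morph l : x y / x - y} by move=> x y; exact: lift_is_additive.
have lU u e : l (gen u e) = h u e by rewrite /l liftU scale1r.
apply: (@tensor_rel_ind (fun x => (l x : W) \in S))
  => [|x y lx ly|u u' e|u e e'|a u e].
- by rewrite -[X in l X](subrr 0) lB subrr; apply: rpred0.
- by rewrite lB; apply: rpredB.
- by rewrite !lB !lU; apply: hDl.
- by rewrite !lB !lU; apply: hDr.
- by rewrite !lB !lU; apply: hZ.
Qed.

Lemma tpureZ a (u : U) (e : E) : tpure (a *: u) e = tpure u (a *: e).
Proof.
by apply/tensor_classP; have [_ _] := tensor_rel_relations U E; apply.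
Qed.

Lemma tensor_class0 : tensor_class (0 : free) = 0.
Proof. by rewrite -[in LHS](subrr 0) tensor_classB subrr. Qed.

Lemma tensor_class_eq0 x : tensor_class x = 0 <-> x \in tensor_rel U E.
Proof.
by rewrite -tensor_class0; split=> [/tensor_classP|xrel];
  [rewrite subr0 | apply/tensor_classP; rewrite subr0].
Qed.

Lemma tpure0 (u : U) : tpure u (0 : E) = 0.
Proof.
have [_ relD _] := tensor_rel_relations U E.
apply/tensor_class_eq0; rewrite -rpredN; have := relD u 0 0.
by rewrite addr0 subrr sub0r.
Qed.

End TensorRelations.

Section FRegular.
Variable R : comPzRingType.

(** The element na (x) 1 of Na (x) R/aR vanishes, because its image n (x) a in
    N (x) R/aR does. Multiplication (x, r) |-> xr maps Na (x) R/aR to Na/Na^2;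
    on representatives it is bilinear modulo Na^2. *)
Lemma F_regular_JT (N : lmodType R) : F_regular N -> weakly_JT_regular N.
Proof.
move=> Freg a n; apply/idP/idP; last exact: scaled_expS.
move=> aNn; have [m nE] := scaledP _ _ aNn.
pose K : submodClosed N := scaled N a.
pose E : lmodType R := quot_lmod (scaled R^o a).
pose k : sub_lmod K := Sub n aNn.
pose u : E := \pi_(quot_lmod (scaled R^o a)) (1 : R^o).
have au : a *: u = 0.
  by rewrite -pi_quot_lmodZ; apply/pi_quot_lmod_eq0/scaledP; exists 1.
have ku0 : tpure k u = 0.
  apply: (Freg K E); rewrite tensor_map_pure.
  have -> : (\val : {linear sub_lmod K -> N}) k = a *: m by [].
  rewrite tpureZ au tpure0.
  by rewrite -[in RHS](subrr 0) tensor_mapB subrr.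
pose h (x : sub_lmod K) (r : quot_lmod (scaled R^o a)) := (repr r : R) *: val x.
have hB (x : sub_lmod K) (r : R^o) :
    r \in scaled R^o a -> (r : R) *: val x \in scaled N (a ^+ 2).
  move=> /scaledP[c rE]; have {rE} -> : (r : R) = a * c := rE.
  have /scaledP[z ->] := valP x; apply/scaledP; exists (c *: z).
  by rewrite !scalerA; congr (_ *: _); ring.
have reprB (r : R^o) :
    repr (\pi_(quot_lmod (scaled R^o a)) r) - r \in scaled R^o a.
  by rewrite -eq_quot_lmod reprK.
have : h k u \in mem_submod (scaled N (a ^+ 2)).
  have /tensor_class_eq0 ku_rel := ku0.
  have := tensor_rel_lift (S := mem_submod (scaled N (a ^+ 2))) (h := h)
    _ _ _ ku_rel.
  rewrite liftU scale1r; apply=> [x x' r|x r r'|b x r].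
  - by rewrite /h (raddfD val x x') scalerDr -addrA -opprD subrr rpred0.
  - rewrite /h -!scalerBl; apply: hB.
    rewrite -addrA -opprD.
    have -> : r + r' = \pi_(quot_lmod (scaled R^o a)) (repr r + repr r').
      by rewrite pi_quot_lmodD !reprK.
    exact: reprB.
  rewrite /h; have -> : val (b *: x) = b *: val x by exact: linearZ.
  rewrite scalerA -scalerBl; apply: hB.
  rewrite -rpredN opprB mulrC; exact: (reprB (b *: (repr r : R^o))).
move=> hku; rewrite -[n]scale1r.
have -> : 1 *: n = h k u - (repr u - 1 : R^o) *: val k.
  by rewrite /h scalerBl opprB addrC subrK.
by rewrite rpredB //; apply/hB/reprB.
Qed.

End FRegular.

(** * Injectivity of tensor maps *)

Lemma freeg_zmod_ind (T : choiceType) (P : {freeg T / int} -> Prop) :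
  P 0 -> (forall x y, P x -> P y -> P (x - y)) -> (forall z, P << z >>) ->
  forall x, P x.
Proof.
move=> P0 PB Pgen x.
pose S : {pred {freeg T / int}} := fun x => `[< P x >].
have S_closed : zmod_closed S.
  by split=> [|y z /asboolP Py /asboolP Pz]; apply/asboolP; [|apply: PB].
pose HS := GRing.isZmodClosed.Build _ S S_closed.
pose SS : zmodClosed _ := HB.pack S HS.
suff : x \in SS by move=> /asboolP.
rewrite -(freeg_sumE x); apply: rpred_sum => z _.
rewrite -[coeff z x]intz -freegU_mulz; apply: rpredMz.
exact/asboolP/Pgen.
Qed.

Section AdjoinOne.
Variables (R : comPzRingType) (U V E : lmodType R) (f : {linear U -> V}).
Variable g : V.
Hypothesis f_inj : injective f.
Hypothesis gen : forall x : V, exists uc : U * R, x = f uc.1 + uc.2 *: g.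
Hypothesis reg : forall a, exists y, a *: g = (y * a ^+ 2) *: g.

(** [eventually Q] says that Q holds for all good enough approximations w of the
    generator g by elements of U. An approximation is a w with f(w) = eg for
    some scalar e, and it improves with the set of s for which sg = seg, that
    is, for which f(sw) = sg. These form a directed set. *)
Definition eventually (Q : U -> Prop) : Prop :=
  exists w0 e0, f w0 = e0 *: g /\ forall w e, f w = e *: g ->
    (forall s, s *: g = (s * e0) *: g -> s *: g = (s * e) *: g) -> Q w.

Lemma eventually_all (Q : U -> Prop) : (forall w, Q w) -> eventually Q.
Proof. by move=> allQ; exists 0, 0; rewrite linear0 scale0r. Qed.

Lemma eventually_const (P : Prop) : eventually (fun=> P) -> P.
Proof. by move=> [w0 [e0 [fw0 Qw]]]; apply: Qw fw0 _. Qed.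

(** Directedness: the complements 1 - e multiply. *)
Lemma eventually_and (Q1 Q2 Q : U -> Prop) :
  eventually Q1 -> eventually Q2 -> (forall w, Q1 w -> Q2 w -> Q w) ->
  eventually Q.
Proof.
move=> [w1 [e1 [fw1 Q1w]]] [w2 [e2 [fw2 Q2w]]] QQ.
exists (w1 + (1 - e1) *: w2), (e1 + (1 - e1) * e2); split.
  by rewrite linearD linearZ /= fw1 fw2 scalerA -scalerDl.
move=> w e fw larger; apply: QQ; [apply: (Q1w _ _ fw)|apply: (Q2w _ _ fw)].
- move=> s se; apply: larger.
  have -> : s * (e1 + (1 - e1) * e2) = s * e1 + e2 * s - e2 * (s * e1) by ring.
  by rewrite scalerBl scalerDl -!(scalerA e2) -se addrK.
- move=> s se; apply: larger.
  have -> : s * (e1 + (1 - e1) * e2) = s * e2 + e1 * s - e1 * (s * e2) by ring.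
  by rewrite scalerBl scalerDl -!(scalerA e1) -se addrK.
Qed.

Lemma eventually_mono (Q1 Q : U -> Prop) :
  eventually Q1 -> (forall w, Q1 w -> Q w) -> eventually Q.
Proof. by move=> ev QQ; apply: (eventually_and ev ev) => w /QQ. Qed.

(** A linear equation d = sw whose constant is compatible with g, as
    f(d) = sg, is solved by all good approximations: if sg = ys^2 g, the first
    one is w = yd, with f(w) = (ys)g. *)
Lemma eventually_solves d s : f d = s *: g -> eventually (fun w => d = s *: w).
Proof.
move=> fd; have [y sy] := reg s.
exists (y *: d), (y * s); split=> [|w e fw larger].
  by rewrite linearZ /= fd scalerA.
apply: f_inj; rewrite linearZ /= fd fw scalerA; apply: larger.
by rewrite sy; congr (_ *: _); ring.
Qed.

(** Each x in V is written, by choice, as f(u) + cg, and [retr w x] is then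
    u + cw. This depends on the choices and is not additive, but every linear
    relation that one asks of it is an equation of the kind solved by
    [eventually_solves], so it holds for good approximations w. Hence [phi w]
    carries a given relation of V (x) E to one of U (x) E for all good w, and
    undoes [free_map f] on a given element. *)
Lemma tensor_map_adjoin_inj : injective (tensor_map (E := E) f).
Proof.
have [uc ucE] := choice gen.
pose retr w x := (uc x).1 + (uc x).2 *: w.
have retrE x u c : x = f u + c *: g ->
    eventually (fun w => retr w x = u + c *: w).
  move=> xE; have /eventually_solves : f ((uc x).1 - u) = (c - (uc x).2) *: g.
    rewrite linearB scalerBl; apply/eqP.
    by rewrite subr_eq addrAC eq_sym subr_eq addrC -xE [X in X == _]ucE addrC.
  move=> ev; apply: (eventually_mono ev) => w dE.
  by rewrite /retr -[(uc x).1](subrK u) dE scalerBl addrAC subrK addrC.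
pose phi w := fglift (fun p : V * E =>
  << (retr w p.1, p.2) >> : {freeg (U * E)%type / int}).
have phiB w : {morph phi w : x y / x - y}.
  by move=> x y; exact: lift_is_additive.
have phi0 w : phi w 0 = 0 by rewrite -[X in phi w X](subrr 0) phiB subrr.
have phi_gen w x e : phi w << (x, e) >> = << (retr w x, e) >>.
  by rewrite /phi liftU scale1r.
have [relDl relDr relZ] := tensor_rel_relations U E.
have phi_rel x : x \in tensor_rel V E ->
    eventually (fun w => phi w x \in tensor_rel U E).
  move: x; apply: tensor_rel_ind => [|x y|x x' e|x e e'|a x e].
  - by apply: eventually_all => w; rewrite phi0 rpred0.
  - move=> evx evy; apply: (eventually_and evx evy) => w.
    by rewrite phiB; apply: rpredB.
  - have ev : eventually (fun w => retr w (x + x') =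
        (uc x).1 + (uc x').1 + ((uc x).2 + (uc x').2) *: w).
      by apply: retrE; rewrite linearD scalerDl addrACA -!ucE.
    apply: (eventually_mono ev) => w wE.
    by rewrite !phiB !phi_gen wE scalerDl addrACA; apply: relDl.
  - by apply: eventually_all => w; rewrite !phiB !phi_gen; apply: relDr.
  - have ev : eventually (fun w =>
        retr w (a *: x) = a *: (uc x).1 + (a * (uc x).2) *: w).
      by apply: retrE; rewrite linearZ -scalerA -scalerDr -ucE.
    apply: (eventually_mono ev) => w wE.
    by rewrite phiB !phi_gen wE -scalerA -scalerDr; apply: relZ.
have phi_id x : eventually (fun w => phi w (free_map f x) = x).
  elim/freeg_zmod_ind: x => [|x y|[u e]].
  - apply: eventually_all => w.
    by rewrite -[X in free_map f X](subrr 0) free_mapB subrr phi0.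
  - move=> evx evy; apply: (eventually_and evx evy) => w xE yE.
    by rewrite free_mapB phiB xE yE.
  have ev : eventually (fun w => retr w (f u) = u + 0 *: w).
    by apply: retrE; rewrite scale0r addr0.
  apply: (eventually_mono ev) => w wE.
  by rewrite free_map_gen phi_gen wE scale0r addr0.
elim/quotW=> x; elim/quotW=> y.
rewrite -!/(tensor_class _) !tensor_map_class => /tensor_classP.
rewrite -free_mapB => /phi_rel xy_rel.
apply/tensor_classP.
apply: (eventually_const (eventually_and xy_rel (phi_id (x - y)) _)) => w.
by move=> + wE; rewrite wE.
Qed.

End AdjoinOne.

Section Adjunction.
Variables (R : comPzRingType) (U V : lmodType R) (f : {linear U -> V}) (g : V).

Definition adjoin : {pred V} := fun x => `[< exists u c, x = f u + c *: g >].

Fact adjoin_closed : submod_closed adjoin.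
Proof.
split=> [|a _ _ /asboolP[u [c ->]] /asboolP[v [d ->]]]; apply/asboolP.
  by exists 0, 0; rewrite linear0 scale0r addr0.
exists (a *: u + v), (a * c + d).
by rewrite linearP scalerDr scalerA scalerDl addrACA.
Qed.
HB.instance Definition _ :=
  GRing.isSubmodClosed.Build R V adjoin
    (GRing.submod_closed_semi adjoin_closed).

Fact mem_adjoin u : f u \in adjoin.
Proof. by apply/asboolP; exists u, 0; rewrite scale0r addr0. Qed.

Definition to_adjoin (u : U) : sub_lmod adjoin := Sub (f u) (mem_adjoin u).

Fact to_adjoin_linear : linear to_adjoin.
Proof.
move=> a u v; apply: val_inj.
by rewrite [RHS]linearP !SubK linearP.
Qed.
HB.instance Definition _ :=
  GRing.isLinear.Build R U (sub_lmod adjoin) _ to_adjoin to_adjoin_linear.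

End Adjunction.

Section TensorInjective.
Variable R : comPzRingType.

Lemma tensor_map_comp (U V W E : lmodType R) (f : {linear U -> V})
    (h : {linear V -> W}) (k : {linear U -> W}) :
  (forall u, h (f u) = k u) ->
  forall t : tensor U E, tensor_map h (tensor_map f t) = tensor_map k t.
Proof.
move=> hfk; elim/quotW=> x; rewrite -!/(tensor_class _) !tensor_map_class.
congr tensor_class; elim/freeg_zmod_ind: x => [|x y xE yE|[u e]].
- by rewrite -(subrr 0) !free_mapB !subrr.
- by rewrite !free_mapB xE yE.
- by rewrite !free_map_gen hfk.
Qed.

(** The map f factors through f(U) + Rg, where g is the first generator: the
    inclusion U -> f(U) + Rg adjoins one generator, and the inclusion of
    f(U) + Rg in V has one generator less to reach. *)
Lemma tensor_map_inj (U V E : lmodType R) (f : {linear U -> V}) (s : seq V) :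
  uniformly_regular V -> injective f ->
  (forall x, exists u, in_span s (x - f u)) ->
  injective (tensor_map (E := E) f).
Proof.
move=> regV; elim: s U f => [|g s IHs] U f f_inj gen.
  (* Here f is onto, so adjoining 0 gives V. *)
  apply: (@tensor_map_adjoin_inj _ _ _ _ f 0) => // [x|a].
    have [u /= /eqP] := gen x; rewrite subr_eq0 => /eqP ->.
    by exists (u, 0); rewrite scaler0 addr0.
  by exists 0; rewrite !scaler0.
pose W := adjoin f g; pose h : {linear sub_lmod W -> V} := \val.
have gW : g \in W by apply/asboolP; exists 0, 1; rewrite linear0 scale1r add0r.
have h_inj : injective (tensor_map (E := E) h).
  apply: IHs => [|x]; first exact: val_inj.
  have [u /= [c [y [sy xE]]]] := gen x.
  have W_el : f u + c *: g \in W by apply/asboolP; exists u, c.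
  exists (Sub (f u + c *: g) W_el); rewrite /h /=.
  by rewrite opprD addrA xE addrC addKr.
have f_inj' : injective (tensor_map (E := E) (to_adjoin f g)).
  apply: (@tensor_map_adjoin_inj _ _ _ _ _ (Sub g gW)) => [u v uv|x|a].
  - by apply: f_inj; have := congr1 val uv.
  - have /asboolP[u [c xE]] := valP x; exists (u, c); apply: val_inj.
    by rewrite xE [RHS]linearD [X in _ = _ + X]linearZ.
  - have [y ay] := regV a; exists y; apply: val_inj.
    by rewrite !linearZ /= ay.
have fE u : h (to_adjoin f g u) = f u by [].
move=> t t'; rewrite -!(tensor_map_comp fE).
by move=> /h_inj /f_inj'.
Qed.

Lemma finitely_generated_F_regular (N : lmodType R) :
  finitely_generated N -> (F_regular N <-> uniformly_regular N).
Proof.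
move=> fgN; split=> [/F_regular_JT|regN K E].
  exact: weakly_JT_uniformly_regular.
have [s gen] := finitely_generated_span fgN.
apply: (tensor_map_inj (s := s)) => // [|x]; first exact: val_inj.
by exists 0; rewrite linear0 subr0.
Qed.

End TensorInjective.

(** * Cyclic submodules of a finitely generated module *)

Section CyclicSubmodules.
Variables (R : comPzRingType) (M : lmodType R).

Definition cyclic_span (m : M) : {pred M} :=
  fun x => `[< exists a, x = a *: m >].

Fact cyclic_span_closed m : submod_closed (cyclic_span m).
Proof.
split=> [|b _ _ /asboolP[c ->] /asboolP[d ->]]; apply/asboolP.
  by exists 0; rewrite scale0r.
by exists (b * c + d); rewrite scalerA scalerDl.
Qed.
HB.instance Definition _ m :=
  GRing.isSubmodClosed.Build R M (cyclic_span m)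
    (GRing.submod_closed_semi (cyclic_span_closed m)).

Lemma cyclic_submod_gen (K : submodClosed M) :
  cyclic_submod K -> exists g : sub_lmod K, forall x, exists a, x = a *: g.
Proof.
move=> [m genK]; have Km : m \in K by apply/genK; exists 1; rewrite scale1r.
exists (Sub m Km) => x; have /genK[a xE] := valP x; exists a.
by apply: val_inj; rewrite xE [RHS]linearZ.
Qed.

(** A uniformly regular M passes its equations to submodules. Conversely, the
    hypothesis at the submodule generated by n gives y for a and n, and these y
    combine over the generators of M. *)
Lemma every_cyclic_submod_regular (P : lmodType R -> Prop) :
  finitely_generated M ->
  (forall N : lmodType R,
     (exists g : N, forall x, exists a, x = a *: g) ->
     (P N <-> uniformly_regular N)) ->
  every_cyclic_submod P M <-> uniformly_regular M.
Proof.
move=> fgM PE; split=> [cycP|regM K /cyclic_submod_gen cycK]; last first.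
  apply/(PE _ cycK) => a; have [y ay] := regM a; exists y => n; apply: val_inj.
  by rewrite !linearZ /= ay.
apply: uniformly_regular_of_pointwise => // a n.
pose K : submodClosed M := cyclic_span n.
have cycK : cyclic_submod K by exists n => x; split=> /asboolP.
have Kn : n \in K by apply/asboolP; exists 1; rewrite scale1r.
have [y ay] := (PE _ (cyclic_submod_gen cycK)).1 (cycP K cycK) a.
by exists y; have := congr1 val (ay (Sub n Kn)); rewrite !linearZ.
Qed.

End CyclicSubmodules.

(** * The equivalences *)

Section Characterizations.
Variables (R : comPzRingType) (N : lmodType R).
Hypothesis fgN : finitely_generated N.

Lemma weakly_morphic_reduced_regular :
  (weakly_morphic N /\ reduced_module N) <-> uniformly_regular N.
Proof.
split=> [[wm red]|reg].
  apply/(finitely_generated_weakly_JT fgN).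
  apply: weakly_JT_regular_of_lmod_iso red => a.
  by exists (scaled N a : submodClosed N), (killed_by N a : submodClosed N).
split; first exact: uniformly_regular_weakly_morphic.
exact: uniformly_regular_reduced.
Qed.

Lemma weakly_endoregular_regular : weakly_endoregular N <-> uniformly_regular N.
Proof.
split=> [/weakly_endoregular_JT|]; first exact: weakly_JT_uniformly_regular.
exact: uniformly_regular_endoregular.
Qed.

Lemma co_reduced_regular : co_reduced N <-> uniformly_regular N.
Proof.
split=> [cored|/uniformly_regular_JT JT a [//|k] _].
  by apply: weakly_JT_uniformly_regular => // a; apply: cored.
elim: k => [|k IHk] n; first by rewrite expr1.
apply/idP/idP; last exact: scaled_expS.
rewrite JT => /scaledP[m ->].
have : a *: m \in scaled N a by apply/scaledP; exists m.
rewrite IHk => /scaledP[x amE]; apply/scaledP; exists x.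
by rewrite expr2 -scalerA amE scalerA -exprS.
Qed.

End Characterizations.

Lemma tfae_iff (Q : Prop) (P0 P1 P2 P3 P4 P5 P6 P7 P8 P9 P10 P11 : Prop) :
  (P0 <-> Q) -> (P1 <-> Q) -> (P2 <-> Q) -> (P3 <-> Q) -> (P4 <-> Q) ->
  (P5 <-> Q) -> (P6 <-> Q) -> (P7 <-> Q) -> (P8 <-> Q) -> (P9 <-> Q) ->
  (P10 <-> Q) -> (P11 <-> Q) ->
  [<-> P0; P1; P2; P3; P4; P5; P6; P7; P8; P9; P10; P11].
Proof. by move=> *; tfae; tauto. Qed.

Theorem theorem5 (R : comPzRingType) (M : lmodType R) :
  nonzero_module M -> finitely_generated M ->
  [<-> weakly_morphic M /\ reduced_module M;
       von_neumann_regular (quot_ring (annihilator M));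
       weakly_endoregular M;
       weakly_JT_regular M;
       F_regular M;
       every_cyclic_submod (fun N => weakly_morphic N /\ reduced_module N) M;
       every_cyclic_submod (fun N => morphic N /\ reduced_module N) M;
       every_cyclic_submod (@weakly_endoregular R) M;
       every_cyclic_submod (@abelian_endoregular R) M;
       every_cyclic_submod (@co_reduced R) M;
       every_cyclic_submod (@weakly_JT_regular R) M;
       every_cyclic_submod (@F_regular R) M].
Proof.
move=> _ fgM; apply: (@tfae_iff (uniformly_regular M)).
- exact: weakly_morphic_reduced_regular.
- exact: quot_ring_annihilator_regular.
- exact: weakly_endoregular_regular.
- exact: finitely_generated_weakly_JT.
- exact: finitely_generated_F_regular.
all: apply: every_cyclic_submod_regular => // N [g gen].
all: have fgN := cyclic_finitely_generated gen.
- exact: weakly_morphic_reduced_regular.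
- exact: (cyclic_morphic_reduced gen).
- exact: weakly_endoregular_regular.
- exact: (cyclic_abelian_endoregular gen).
- exact: co_reduced_regular.
- exact: finitely_generated_weakly_JT.
- exact: finitely_generated_F_regular.
Qed.
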